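(* Let $f:[0,+\infty)\to\mathbb R$ be of bounded variation. 1. The series $\sum_{k=0}^{\infty}f(k)$ and the generalized integral $\int_0^{+\infty}f(x)\,dx$ have the same behavior: either both are convergent or both are divergent. 2. Assume that the series $\sum_{k=0}^{\infty}f(k)$ converges. Then for every $n\in\mathbb N$ $$\sum_{k=0}^{\infty}f(k)=\sum_{0\le k<n}f(k)+\int_n^{+\infty}f(x)\,dx-\frac12\big(f(\infty)-f(n)\big)+\varepsilon_1(n),\qquad |\varepsilon_1(n)|\le\frac12\,\mathrm{pV}(f,[n,+\infty)),$$ that is, the real number $\varepsilon_1(n)$ defined by the equality satisfies the inequality.
   Context: For a real-valued function $f$ on an interval $I$, the pointwise variation of $f$ on $I$ is $$\mathrm{pV}(f,I):=\sup\Big\{\sum_{0\le i<m}|f(t_{i+1})-f(t_i)|:\ t_i\in I,\ t_0<t_1<\dots<t_m\Big\},$$ and $f$ is of bounded variation on $I$ if $\mathrm{pV}(f,I)<+\infty$. $\mathbb N=\{0,1,2,\dots\}$, and $\sum_{0\le k<n}f(k)=\sum_{k=0}^{n-1}f(k)$ (empty sum equal to $0$). The generalized (improper) integral is $\int_n^{+\infty}f(x)\,dx:=\lim_{c\to+\infty}\int_n^c f(x)\,dx$ ($c$ real); it is convergent if this limit exists and is finite, and divergent otherwise (absolute integrability is not required). Likewise the series converges if its partial sums have a finite limit, and diverges otherwise. If $f$ is of bounded variation on $[0,+\infty)$, then $f(\infty):=\lim_{x\to+\infty}f(x)$ exists and is finite. *)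

(* Defs.v *)
From Stdlib Require Import Reals.
From Coquelicot Require Import Coquelicot.

Open Scope R_scope.

(* Sum over 0 <= k < n; Stdlib's [sum_f_R0] and Coquelicot's [sum_n] have
   n + 1 terms and so cannot express the empty sum. *)
Fixpoint sum_lt (a : nat -> R) (n : nat) : R :=
  match n with
  | O => 0
  | S m => sum_lt a m + a m
  end.

Definition ray (a : R) : R -> Prop := fun x => a <= x.

(* Only the values t 0, ..., t m of the sequence t matter. *)
Definition is_variation_sum (f : R -> R) (I : R -> Prop) (s : R) : Prop :=
  exists (m : nat) (t : nat -> R),
    (forall i : nat, (i <= m)%nat -> I (t i)) /\
    (forall i : nat, (i < m)%nat -> t i < t (S i)) /\
    s = sum_lt (fun i => Rabs (f (t (S i)) - f (t i))) m.

Definition pV (f : R -> R) (I : R -> Prop) : Rbar :=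
  Lub_Rbar (is_variation_sum f I).

Definition bv_on (f : R -> R) (I : R -> Prop) : Prop :=
  Rbar_lt (pV f I) p_infty.

(* Limit, as c tends to +oo, of the Riemann integral of f over [a, c]. *)
Definition is_improper_int (f : R -> R) (a l : R) : Prop :=
  is_RInt_gen f (at_point a) (Rbar_locally p_infty) l.

Definition ex_improper_int (f : R -> R) (a : R) : Prop :=
  exists l : R, is_improper_int f a l.

(* Main.v *)
Require Import Defs.
From Stdlib Require Import Reals Lra Lia Classical.
From Coquelicot Require Import Coquelicot.
Open Scope R_scope.

(** The tail variation [W x = pV f [x, +oo)] satisfies
    [|f y - f x| <= W x - W y] for [x <= y], and everything follows from this
    inequality alone.  It gives the integrability of [f] (compare [f] with its
    left-endpoint step functions) and the limit of [f] at infinity (Cauchy).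
    For [k <= x <= k + 1] it bounds the distance from [f x] to
    [(f k + f (k + 1)) / 2] by [(W k - W (k + 1)) / 2].  Integrating and
    summing, the error of the trapezoidal rule telescopes, so it converges and
    its tail from [n] on is at most [W n / 2]. *)

(** * Finite sums and series *)

Lemma sum_lt_Sl (a : nat -> R) (m : nat) :
  sum_lt a (S m) = a O + sum_lt (fun i => a (S i)) m.
Proof.
  induction m as [|m IH]; [simpl; ring|].
  change (sum_lt a (S m) + a (S m) =
    a O + (sum_lt (fun i => a (S i)) m + a (S m))).
  rewrite IH; ring.
Qed.

Lemma sum_lt_sum_n (a : nat -> R) (n : nat) : sum_lt a (S n) = sum_n a n.
Proof.
  induction n as [|n IH].
  - rewrite sum_O; simpl; ring.
  - rewrite sum_Sn, <- IH; reflexivity.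
Qed.

Lemma is_series_sum_lt (a : nat -> R) (l : R) :
  is_series a l <-> is_lim_seq (sum_lt a) l.
Proof.
  rewrite (is_lim_seq_incr_1 (sum_lt a) l).
  split; intros H.
  - apply is_lim_seq_ext with (sum_n a); [|exact H].
    intros n; symmetry; apply sum_lt_sum_n.
  - apply (is_lim_seq_ext _ (sum_n a) l (sum_lt_sum_n a) H).
Qed.

(** * Variation sums on rays and the tail variation *)

Definition controls (W f : R -> R) (a : R) : Prop :=
  forall x y : R, a <= x -> x <= y -> Rabs (f y - f x) <= W x - W y.

(** Pinning the first node makes it possible to prepend a point on the left and know exactly which
    term is added. *)
Definition variation_sum_from (f : R -> R) (I : R -> Prop) (x s : R) : Prop :=
  exists (m : nat) (t : nat -> R),
    t O = x /\
    (forall i : nat, (i <= m)%nat -> I (t i)) /\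
    (forall i : nat, (i < m)%nat -> t i < t (S i)) /\
    s = sum_lt (fun i => Rabs (f (t (S i)) - f (t i))) m.

Lemma variation_sum_from_cons (f : R -> R) (I : R -> Prop) (x y s : R) :
  I x -> x < y -> variation_sum_from f I y s ->
  variation_sum_from f I x (Rabs (f y - f x) + s).
Proof.
  intros Ix xy (m & t & t0 & tI & tlt & ->).
  exists (S m), (fun i => match i with O => x | S j => t j end).
  split; [reflexivity|]. split; [|split].
  - intros [|i] Hi; [exact Ix | apply tI; lia].
  - intros [|i] Hi; [rewrite t0; exact xy | apply tlt; lia].
  - rewrite sum_lt_Sl, t0; reflexivity.
Qed.

Lemma variation_sum_from_is (f : R -> R) (I : R -> Prop) (x s : R) :
  variation_sum_from f I x s -> is_variation_sum f I s.
Proof. intros (m & t & _ & H); exists m, t; exact H. Qed.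

Lemma is_variation_sum_sub (f : R -> R) (I J : R -> Prop) (s : R) :
  (forall x, I x -> J x) -> is_variation_sum f I s -> is_variation_sum f J s.
Proof. intros IJ (m & t & tI & H); exists m, t; split; [auto | exact H]. Qed.

(** Either the first node is already [y], or it lies to the right and [y] can be prepended, which
    adds a nonnegative term. *)
Lemma variation_sum_ray_from (f : R -> R) (y s : R) :
  is_variation_sum f (ray y) s ->
  exists s', s <= s' /\ variation_sum_from f (ray y) y s'.
Proof.
  intros (m & t & tI & tlt & ->).
  set (s := sum_lt _ m).
  assert (Ht : variation_sum_from f (ray y) (t O) s) by (exists m, t; auto).
  destruct (tI O (Nat.le_0_l m)) as [H|H].
  - exists (Rabs (f (t O) - f y) + s). split.
    + generalize (Rabs_pos (f (t O) - f y)); lra.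
    + apply variation_sum_from_cons; [apply Rle_refl | exact H | exact Ht].
  - exists s. split; [apply Rle_refl|]. rewrite H at 2. exact Ht.
Qed.

Lemma is_variation_sum_ray_0 (f : R -> R) (x : R) :
  is_variation_sum f (ray x) 0.
Proof.
  exists O, (fun _ => x). repeat split; [intros; apply Rle_refl | lia].
Qed.

(** The supremum is squeezed between the empty sum 0 and the variation on the larger ray from
    [a]. *)
Lemma pV_ray_finite (f : R -> R) (a x : R) :
  bv_on f (ray a) -> a <= x -> is_finite (pV f (ray x)).
Proof.
  intros Hbv ax.
  destruct (Lub_Rbar_correct (is_variation_sum f (ray a))) as [ub _].
  destruct (Lub_Rbar_correct (is_variation_sum f (ray x))) as [ubx lubx].
  fold (pV f (ray a)) in ub. fold (pV f (ray x)) in ubx, lubx.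
  assert (H1 : Rbar_le (pV f (ray x)) (pV f (ray a))).
  { apply lubx. intros s Hs. apply ub.
    apply is_variation_sum_sub with (ray x); [|exact Hs].
    intros z Hz; unfold ray in *; lra. }
  assert (H0 := ubx 0 (is_variation_sum_ray_0 f x)).
  unfold bv_on in Hbv.
  destruct (pV f (ray x)), (pV f (ray a)); simpl in *; try easy.
Qed.

Lemma pV_ray_ge0 (f : R -> R) (a x : R) :
  bv_on f (ray a) -> a <= x -> 0 <= real (pV f (ray x)).
Proof.
  intros Hbv ax.
  destruct (Lub_Rbar_correct (is_variation_sum f (ray x))) as [ubx _].
  fold (pV f (ray x)) in ubx.
  specialize (ubx 0 (is_variation_sum_ray_0 f x)).
  rewrite <- (pV_ray_finite f a x Hbv ax) in ubx. exact ubx.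
Qed.

(** Any variation sum on the ray from [y] may be taken to start at [y]; prepending [x] then gives a
    sum on the ray from [x], larger by [Rabs (f y - f x)]. The supremum over the first sums yields
    the inequality. *)
Lemma bv_controls (f : R -> R) (a : R) :
  bv_on f (ray a) -> controls (fun x => real (pV f (ray x))) f a.
Proof.
  intros Hbv x y ax [xy|<-]; [|rewrite !Rminus_diag, Rabs_R0; apply Rle_refl].
  destruct (Lub_Rbar_correct (is_variation_sum f (ray x))) as [ubx _].
  destruct (Lub_Rbar_correct (is_variation_sum f (ray y))) as [_ luby].
  fold (pV f (ray x)) in ubx. fold (pV f (ray y)) in luby.
  assert (H : Rbar_le (pV f (ray y))
                (Finite (real (pV f (ray x)) - Rabs (f y - f x)))).
  { apply luby. intros s Hs.
    destruct (variation_sum_ray_from f y s Hs) as (s' & ss' & Hs').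
    assert (Hc : is_variation_sum f (ray x) (Rabs (f y - f x) + s')).
    { apply variation_sum_from_is with x.
      apply variation_sum_from_cons; [apply Rle_refl | exact xy |].
      destruct Hs' as (m & t & t0 & tI & H).
      exists m, t. split; [exact t0|]. split; [|exact H].
      intros i Hi. specialize (tI i Hi). unfold ray in *; lra. }
    specialize (ubx _ Hc). rewrite <- (pV_ray_finite f a x Hbv ax) in ubx.
    simpl in *; lra. }
  assert (ay : a <= y) by lra.
  rewrite <- (pV_ray_finite f a y Hbv ay) in H. simpl in H; lra.
Qed.

(** * Riemann integrability by squeezing *)

Lemma ex_RInt_squeeze (f : R -> R) (a b : R) :
  a < b ->
  (forall eps : posreal, exists phi psi : R -> R,
     ex_RInt phi a b /\ ex_RInt psi a b /\
     (forall x, a <= x <= b -> Rabs (f x - phi x) <= psi x) /\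
     RInt psi a b < eps) ->
  ex_RInt f a b.
Proof.
  intros ab H.
  (* Cauchy criterion for Riemann sums: on fine subdivisions the sum of [f] is within [eps / 4] of
     that of [phi], itself within [eps / 4] of its integral, so two sums of [f] differ by less than
     [eps]. *)
  apply (proj1 (filterlim_locally_cauchy (U := R_CompleteNormedModule)
    (F := Riemann_fine a b)
    (fun ptd => scal (sign (b - a)) (Riemann_sum f ptd)))).
  intros eps.
  assert (e4 : 0 < eps / 4) by (generalize (cond_pos eps); lra).
  destruct (H (mkposreal _ e4)) as (phi & psi & [Iphi Hphi] & Hpsi & bnd & small).
  apply (RInt_correct (V := R_CompleteNormedModule)) in Hpsi.
  set (Ipsi := RInt psi a b) in *. simpl in small.
  unfold is_RInt in Hphi, Hpsi.
  assert (Hphi' := proj1 (filterlim_locally _ _) Hphi (mkposreal _ e4)).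
  (* The radius [eps / 4 - Ipsi] keeps the Riemann sums of [psi] below [eps / 4]. *)
  assert (Hpsi' := proj1 (filterlim_locally _ _) Hpsi
    (mkposreal (eps / 4 - Ipsi) (proj2 (Rlt_0_minus _ _) small))).
  assert (Hd : Riemann_fine a b (fun ptd => pointed_subdiv ptd /\
    SF_h ptd = Rmin a b /\ seq.last (SF_h ptd) (SF_lx ptd) = Rmax a b)).
  { unfold Riemann_fine, within. apply filter_forall. auto. }
  eexists. split.
  { exact (filter_and _ _ (filter_and _ _ Hphi' Hpsi') Hd). }
  rewrite sign_eq_1 by lra.
  assert (key : forall u : SF_seq,
    (ball Iphi (eps / 4) (scal 1 (Riemann_sum phi u)) /\
     ball Ipsi (eps / 4 - Ipsi) (scal 1 (Riemann_sum psi u))) /\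
    pointed_subdiv u /\ SF_h u = Rmin a b /\
      seq.last (SF_h u) (SF_lx u) = Rmax a b ->
    Rabs (Riemann_sum f u - Iphi) < eps / 2).
  { intros u ((B1 & B2) & pu & hu & lu).
    rewrite Rmin_left in hu by lra. rewrite Rmax_right in lu by lra.
    assert (N := Riemann_sum_norm (V := R_NormedModule)
      (fun x => minus (f x) (phi x)) psi u pu).
    rewrite lu, hu in N. specialize (N bnd).
    rewrite (Riemann_sum_minus (V := R_ModuleSpace)) in N.
    unfold ball in B1, B2; simpl in B1, B2;
      unfold AbsRing_ball, abs, minus, plus, opp, scal in B1, B2; simpl in B1, B2.
    unfold mult in B1, B2; simpl in B1, B2.
    rewrite Rmult_1_l in B1, B2.
    unfold norm, minus, plus, opp in N; simpl in N. unfold abs in N; simpl in N.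
    revert N B1 B2. unfold Rabs; repeat destruct Rcase_abs; lra. }
  intros u v Hu Hv. apply key in Hu, Hv.
  unfold ball; simpl; unfold AbsRing_ball, abs, minus, plus, opp, scal; simpl.
  unfold mult; simpl. rewrite !Rmult_1_l.
  revert Hu Hv. unfold Rabs; repeat destruct Rcase_abs; lra.
Qed.

(** On each cell from [c] to [c + h], [phi] is the left-endpoint value [f c] and [psi] is the drop
    [W c - W (c + h)]. The integrals of [psi] over the cells telescope. *)
Lemma controls_step_approx (W f : R -> R) (a h : R) :
  controls W f a -> 0 <= h -> forall k : nat, exists phi psi : R -> R,
    ex_RInt phi a (a + INR k * h) /\
    is_RInt psi a (a + INR k * h) (h * (W a - W (a + INR k * h))) /\
    (forall x, a <= x <= a + INR k * h -> Rabs (f x - phi x) <= psi x).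
Proof.
  intros HW h0 k. induction k as [|k (phi & psi & Iphi & Ipsi & bnd)].
  - exists f, (fun _ => 0). simpl. rewrite Rmult_0_l, Rplus_0_r. split; [|split].
    + apply ex_RInt_point.
    + replace (h * (W a - W a)) with (zero : R) by (unfold zero; simpl; ring).
      apply (is_RInt_point (V := R_NormedModule)).
    + intros x _. rewrite Rminus_diag, Rabs_R0. apply Rle_refl.
  - set (c := a + INR k * h) in *.
    set (d := a + INR (S k) * h).
    assert (cd : d = c + h) by (unfold c, d; rewrite S_INR; ring).
    assert (ac : a <= c).
    { unfold c. generalize (Rmult_le_pos _ _ (pos_INR k) h0); lra. }
    exists (fun x => if Rle_dec x c then phi x else f c),
           (fun x => if Rle_dec x c then psi x else W c - W d).
    split; [|split].
    + apply ex_RInt_Chasles with c.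
      * apply ex_RInt_ext with phi; [|exact Iphi].
        intros x. rewrite Rmax_right by lra. intros Hx.
        destruct (Rle_dec x c); [reflexivity | lra].
      * apply ex_RInt_ext with (fun _ => f c); [|apply ex_RInt_const].
        intros x. rewrite Rmin_left by lra. intros Hx.
        destruct (Rle_dec x c); [lra | reflexivity].
    + replace (h * (W a - W d)) with
        (plus (h * (W a - W c)) (scal (d - c) (W c - W d)))
        by (rewrite cd; unfold plus, scal; simpl; unfold mult; simpl; ring).
      apply (is_RInt_Chasles (V := R_NormedModule)) with c.
      * apply is_RInt_ext with psi; [|exact Ipsi].
        intros x. rewrite Rmax_right by lra. intros Hx.
        destruct (Rle_dec x c); [reflexivity | lra].
      * apply is_RInt_ext with (fun _ => W c - W d); [|apply (is_RInt_const (V := R_NormedModule))].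
        intros x. rewrite Rmin_left by lra. intros Hx.
        destruct (Rle_dec x c); [lra | reflexivity].
    + intros x Hx. destruct (Rle_dec x c) as [xc|xc]; [apply bnd; lra|].
      assert (H1 := HW c x ac ltac:(lra)).
      (* Gives [W d <= W x], which turns the bound [W c - W x] into the constant [W c - W d]. *)
      assert (H2 := HW x d ltac:(lra) ltac:(lra)).
      generalize (Rabs_pos (f d - f x)); lra.
Qed.

Lemma controls_ex_RInt (W f : R -> R) (a b c : R) :
  controls W f a -> a <= b -> b <= c -> ex_RInt f b c.
Proof.
  intros HW0 ab [bc|<-]; [|apply ex_RInt_point].
  assert (HW : controls W f b) by (intros x y bx xy; apply HW0; lra).
  apply ex_RInt_squeeze; [exact bc|]. intros eps.
  assert (M0 : 0 <= W b - W c).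
  { generalize (HW b c (Rle_refl b) (Rlt_le _ _ bc)) (Rabs_pos (f c - f b)); lra. }
  (* With [S N] equal cells the integral of [psi] is [(c - b) * (W b - W c) / INR (S N)]; this
     choice of [N] makes it less than [eps]. *)
  destruct (nfloor_ex ((c - b) * (W b - W c) / eps)) as [N [_ HN]].
  { apply Rdiv_le_0_compat; [apply Rmult_le_pos; lra | apply cond_pos]. }
  rewrite <- S_INR in HN.
  assert (Npos : 0 < INR (S N)) by (apply lt_0_INR; lia).
  assert (h0 : 0 <= (c - b) / INR (S N)) by (apply Rdiv_le_0_compat; lra).
  destruct (controls_step_approx W f b _ HW h0 (S N))
    as (phi & psi & Iphi & Ipsi & bnd).
  replace (b + INR (S N) * ((c - b) / INR (S N))) with c in * by (field; lra).
  exists phi, psi.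
  split; [exact Iphi|]. split; [eexists; exact Ipsi|]. split; [exact bnd|].
  rewrite (is_RInt_unique _ _ _ _ Ipsi).
  apply Rlt_div_l in HN; [|apply cond_pos].
  replace ((c - b) / INR (S N) * (W b - W c))
    with ((c - b) * (W b - W c) / INR (S N)) by (field; lra).
  apply Rlt_div_l; [exact Npos|]. lra.
Qed.

(** * Limits of controlled sequences and functions *)

Lemma ex_finite_lim_seq_controlled (u w : nat -> R) :
  (forall n, Rabs (u (S n) - u n) <= w n - w (S n)) -> (forall n, 0 <= w n) ->
  ex_finite_lim_seq u.
Proof.
  intros Hu Hw.
  assert (Hu' : forall n, w (S n) - w n <= u (S n) - u n <= w n - w (S n)).
  { intros n. generalize (proj1 (Rabs_le_between _ _) (Hu n)); lra. }
  assert (Hlow : forall n, u O - w O <= u n - w n).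
  { induction n as [|n IH]; [lra|]. generalize (Hu' n); lra. }
  (* Both [u + w] and [w] are nonincreasing and bounded below, so [u] converges as their
     difference. *)
  destruct (ex_finite_lim_seq_decr (fun n => u n + w n) (u O - w O)) as [l1 L1].
  { intros n. generalize (Hu' n); lra. }
  { intros n. generalize (Hlow n) (Hw n); lra. }
  destruct (ex_finite_lim_seq_decr w 0) as [l2 L2]; [|exact Hw|].
  { intros n. generalize (Hu' n); lra. }
  exists (l1 - l2).
  apply is_lim_seq_ext with (fun n => (u n + w n) - w n).
  { intros n; ring. }
  apply is_lim_seq_minus'; assumption.
Qed.

Lemma nat_above (x : R) : exists n : nat, x <= INR n.
Proof.
  destruct (Rle_dec 0 x) as [H|H].
  - destruct (nfloor_ex x H) as [n Hn]. exists (S n). rewrite S_INR; lra.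
  - exists O. simpl; lra.
Qed.

(** Let [w] be the limit of the nonincreasing [W] along the integers. For [INR N < u <= v] the
    oscillation [Rabs (f v - f u)] is at most [W (INR N) - w], so [f] is Cauchy at infinity. *)
Lemma controls_ex_lim (W f : R -> R) :
  controls W f 0 -> (forall x, 0 <= x -> 0 <= W x) ->
  exists l : R, is_lim f p_infty l.
Proof.
  intros HW W0.
  assert (Wdecr : forall x y, 0 <= x -> x <= y -> W y <= W x).
  { intros x y x0 xy. generalize (HW x y x0 xy) (Rabs_pos (f y - f x)); lra. }
  assert (dW : forall n, W (INR (S n)) <= W (INR n)).
  { intros n. apply Wdecr; [apply pos_INR | apply le_INR; lia]. }
  destruct (ex_finite_lim_seq_decr (fun n => W (INR n)) 0) as [w Hw]; [exact dW| |].
  { intros n. apply W0, pos_INR. }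
  assert (wle : forall x, 0 <= x -> w <= W x).
  { intros x x0. destruct (nat_above x) as [n Hn].
    apply Rle_trans with (W (INR n)); [|apply Wdecr; assumption].
    apply (is_lim_seq_decr_compare (fun n => W (INR n)) w Hw dW n). }
  apply (proj1 (filterlim_locally_cauchy (U := R_CompleteSpace)
    (F := Rbar_locally p_infty) f)).
  intros eps.
  apply is_lim_seq_spec in Hw. destruct (Hw eps) as [N HN].
  specialize (HN N (Nat.le_refl N)).
  assert (N0 := pos_INR N).
  exists (fun x => INR N < x). split.
  { exists (INR N). auto. }
  assert (key : forall u v, INR N < u -> u <= v -> Rabs (f v - f u) < eps).
  { intros u v Hu uv.
    generalize (HW u v ltac:(lra) uv) (wle v ltac:(lra)) (Wdecr (INR N) u N0 ltac:(lra))
      (Rle_abs (W (INR N) - w)). lra. }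
  intros u v Hu Hv. unfold ball; simpl; unfold AbsRing_ball, abs, minus, plus, opp; simpl.
  destruct (Rle_dec u v) as [uv|uv].
  - apply (key u v Hu uv).
  - rewrite <- Rabs_Ropp. replace (- (f v + - f u)) with (f u - f v) by ring.
    apply (key v u Hv). lra.
Qed.

(** * Improper integrals as limits, along reals and along integers *)

Lemma is_improper_int_lim (f : R -> R) (a l : R) :
  (forall c, a <= c -> ex_RInt f a c) ->
  is_improper_int f a l <-> is_lim (RInt f a) p_infty l.
Proof.
  intros Hf. split.
  - intros H P HP. destruct (H P HP) as [Q R HQ [M HM] HQR].
    exists M. intros c Hc.
    destruct (HQR a c HQ (HM c Hc)) as (y & Hy & Py). simpl in Hy.
    rewrite (is_RInt_unique _ _ _ _ Hy). exact Py.
  - intros H P HP. destruct (H P HP) as [M HM].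
    apply (Filter_prod _ _ _ (fun x => x = a) (fun c => Rmax a M < c)).
    + reflexivity.
    + exists (Rmax a M). auto.
    + intros x c -> Hc. simpl. exists (RInt f a c).
      assert (Ha := Rmax_l a M). assert (HM' := Rmax_r a M).
      split; [apply @RInt_correct, Hf; lra | apply HM; lra].
Qed.

(** For [m] the integer part of [c], the leftover integral from [m] to [c] runs over a length below
    1, where [f] is small. *)
Lemma is_lim_RInt_of_nat (f : R -> R) (l : R) :
  (forall b c, 0 <= b -> b <= c -> ex_RInt f b c) ->
  is_lim f p_infty 0 ->
  is_lim_seq (fun n => RInt f 0 (INR n)) l ->
  is_lim (RInt f 0) p_infty l.
Proof.
  intros Hf f0 HF.
  apply is_lim_spec. intros eps.
  assert (e2 : 0 < eps / 2) by (generalize (cond_pos eps); lra).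
  apply is_lim_spec in f0. destruct (f0 (mkposreal _ e2)) as [M HM]. simpl in HM.
  apply is_lim_seq_spec in HF. destruct (HF (mkposreal _ e2)) as [N HN]. simpl in HN.
  (* The extra 1 ensures that the integer part of [c], and not merely [c], exceeds [N] and [M]. *)
  exists (Rmax (INR N) (Rmax M 0) + 1). intros c Hc.
  assert (A1 := Rmax_l (INR N) (Rmax M 0)). assert (A2 := Rmax_r (INR N) (Rmax M 0)).
  assert (A3 := Rmax_l M 0). assert (A4 := Rmax_r M 0).
  destruct (nfloor_ex c) as [m Hm]; [lra|].
  assert (m0 := pos_INR m).
  assert (Nm : (N <= m)%nat) by (apply INR_le; lra).
  specialize (HN m Nm).
  rewrite <- (RInt_Chasles f 0 (INR m) c) by (apply Hf; lra).
  assert (Hi : Rabs (RInt f (INR m) c) <= (c - INR m) * (eps / 2)).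
  { apply abs_RInt_le_const; [lra | apply Hf; lra |].
    intros t Ht. specialize (HM t ltac:(lra)). rewrite Rminus_0_r in HM. lra. }
  assert (Hi' : Rabs (RInt f (INR m) c) <= eps / 2).
  { apply Rle_trans with (1 := Hi). rewrite <- (Rmult_1_l (eps / 2)) at 2.
    apply Rmult_le_compat_r; lra. }
  unfold plus; simpl.
  replace (RInt f 0 (INR m) + RInt f (INR m) c - l)
    with ((RInt f 0 (INR m) - l) + RInt f (INR m) c) by ring.
  apply Rle_lt_trans with (1 := Rabs_triang _ _). lra.
Qed.

(** * The trapezoidal rule and its accumulated error *)

Lemma controls_trapezoid (W f : R -> R) (a b : R) :
  controls W f a -> a <= b ->
  Rabs (RInt f b (b + 1) - (f b + f (b + 1)) / 2) <= (W b - W (b + 1)) / 2.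
Proof.
  intros HW ab.
  set (m := (f b + f (b + 1)) / 2).
  assert (If : ex_RInt f b (b + 1)) by (apply controls_ex_RInt with W a; [exact HW|lra|lra]).
  assert (Id := is_RInt_minus (V := R_NormedModule) _ _ _ _ _ _
    (RInt_correct f _ _ If) (is_RInt_const b (b + 1) m)).
  change (is_RInt (fun x => f x - m) b (b + 1)
    (RInt f b (b + 1) - (b + 1 - b) * m)) in Id.
  replace ((b + 1 - b) * m) with m in Id by ring.
  rewrite <- (is_RInt_unique _ _ _ _ Id).
  replace ((W b - W (b + 1)) / 2) with ((b + 1 - b) * ((W b - W (b + 1)) / 2)) by field.
  apply abs_RInt_le_const; [lra | eexists; exact Id |].
  intros x Hx.
  (* [f x - m] is the average of [f x - f b] and [f x - f (b + 1)]; in the sum of the two bounds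
     [W x] cancels. *)
  assert (H1 := HW b x ab ltac:(lra)).
  assert (H2 := HW x (b + 1) ltac:(lra) ltac:(lra)).
  unfold m.
  revert H1 H2. unfold Rabs; repeat destruct Rcase_abs; lra.
Qed.

(** Integral minus trapezoidal sum: averaging the endpoint values changes the left-endpoint sum by
    [(f (INR n) - f 0) / 2]. *)
Definition trapezoid_error (f : R -> R) (n : nat) : R :=
  RInt f 0 (INR n) - sum_lt (fun k => f (INR k)) n + (f 0 - f (INR n)) / 2.

(** The increment is the error on the single cell from [n] to [n + 1]. The bound is split into
    halves to be a difference of consecutive values of [W / 2]. *)
Lemma trapezoid_error_step (W f : R -> R) (n : nat) :
  controls W f 0 ->
  Rabs (trapezoid_error f (S n) - trapezoid_error f n)
    <= W (INR n) / 2 - W (INR (S n)) / 2.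
Proof.
  intros HW. assert (n0 := pos_INR n).
  assert (H := controls_trapezoid W f 0 (INR n) HW n0).
  rewrite <- S_INR in H.
  assert (C : RInt f 0 (INR (S n)) =
    RInt f 0 (INR n) + RInt f (INR n) (INR (S n))).
  { symmetry; apply (RInt_Chasles f); apply controls_ex_RInt with W 0; auto;
      try rewrite S_INR; lra. }
  unfold trapezoid_error. rewrite C.
  replace (W (INR n) / 2 - W (INR (S n)) / 2)
    with ((W (INR n) - W (INR (S n))) / 2) by field.
  eapply Rle_trans; [|exact H]. apply Req_le. f_equal. cbn [sum_lt]. field.
Qed.

Lemma trapezoid_error_bound (W f : R -> R) (n j : nat) :
  controls W f 0 ->
  Rabs (trapezoid_error f (n + j) - trapezoid_error f n)
    <= W (INR n) / 2 - W (INR (n + j)) / 2.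
Proof.
  intros HW. induction j as [|j IH].
  - rewrite Nat.add_0_r, !Rminus_diag, Rabs_R0. apply Rle_refl.
  - rewrite Nat.add_succ_r.
    assert (H := trapezoid_error_step W f (n + j) HW).
    revert IH H. unfold Rabs; repeat destruct Rcase_abs; lra.
Qed.

(** * Comparison of the series with the improper integral, and the remainder *)

Theorem corollary2p5 :
  forall (f : R -> R),
    bv_on f (ray 0) ->
    ((ex_series (fun k : nat => f (INR k)) /\ ex_improper_int f 0) \/
     (~ ex_series (fun k : nat => f (INR k)) /\ ~ ex_improper_int f 0)) /\
    (ex_series (fun k : nat => f (INR k)) ->
     forall n : nat,
       exists (J finf eps1 : R),
         is_improper_int f (INR n) J /\
         is_lim f p_infty (Finite finf) /\
         Series (fun k : nat => f (INR k)) =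
           sum_lt (fun k : nat => f (INR k)) n + J
             - 1 / 2 * (finf - f (INR n)) + eps1 /\
         Rbar_le (Finite (Rabs eps1))
           (Rbar_mult (Finite (1 / 2)) (pV f (ray (INR n))))).
Proof.
  intros f Hbv.
  pose (W := fun x => real (pV f (ray x))).
  assert (HW : controls W f 0) by (apply bv_controls; exact Hbv).
  assert (W0 : forall x, 0 <= x -> 0 <= W x)
    by (intros x; apply pV_ray_ge0; exact Hbv).
  assert (Hint : forall b c, 0 <= b -> b <= c -> ex_RInt f b c)
    by (intros b c; apply controls_ex_RInt with (1 := HW)).
  destruct (controls_ex_lim W f HW W0) as [L HL].
  assert (HLn : is_lim_seq (fun n => f (INR n)) L).
  { apply is_lim_comp_seq with p_infty; [exact HL | | exact is_lim_seq_INR].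
    exists O; discriminate. }
  assert (HT : ex_finite_lim_seq (trapezoid_error f)).
  { apply ex_finite_lim_seq_controlled with (fun n => W (INR n) / 2).
    - intros n. apply trapezoid_error_step; exact HW.
    - intros n. generalize (W0 _ (pos_INR n)); lra. }
  destruct HT as [T HT].
  set (a := fun k : nat => f (INR k)).
  assert (Hhalf : is_lim_seq (fun n => (f 0 - f (INR n)) / 2) ((f 0 - L) / 2)).
  { apply (is_lim_seq_scal_r (fun n => f 0 - f (INR n)) (/ 2) (f 0 - L)).
    apply is_lim_seq_minus'; [apply is_lim_seq_const | exact HLn]. }
  (* Solving the definition of [trapezoid_error] for the integral and letting [n] tend to infinity
     produces this value. *)
  assert (series_to_int : forall S : R, is_series a S ->
    is_lim (RInt f 0) p_infty (T + S - (f 0 - L) / 2)).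
  { intros S HS.
    (* The terms of a convergent series tend to 0, hence so does [f]; this allows passing from
       integer to real upper endpoints. *)
    assert (L0 : L = 0).
    { assert (Z : is_lim_seq a 0) by (apply ex_series_lim_0; exists S; exact HS).
      apply is_lim_seq_unique in Z. unfold a in Z.
      rewrite (is_lim_seq_unique _ _ HLn) in Z. injection Z; auto. }
    apply is_lim_RInt_of_nat; [exact Hint | rewrite <- L0; exact HL |].
    apply is_lim_seq_ext with
      (fun n => trapezoid_error f n + sum_lt a n - (f 0 - f (INR n)) / 2).
    { intros n. unfold trapezoid_error. fold a. ring. }
    apply is_lim_seq_minus'; [|exact Hhalf].
    apply is_lim_seq_plus'; [exact HT | apply is_series_sum_lt, HS]. }
  (* Conversely, the integral is sampled at integers and the same identity is solved for the partial
     sum. *)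
  assert (int_to_series : forall I : R, is_lim (RInt f 0) p_infty I -> ex_series a).
  { intros I HI. exists (I - T + (f 0 - L) / 2). apply is_series_sum_lt.
    apply is_lim_seq_ext with
      (fun n => RInt f 0 (INR n) - trapezoid_error f n + (f 0 - f (INR n)) / 2).
    { intros n. unfold trapezoid_error. fold a. ring. }
    apply is_lim_seq_plus'; [|exact Hhalf].
    apply is_lim_seq_minus'; [|exact HT].
    apply is_lim_comp_seq with p_infty; [exact HI | | exact is_lim_seq_INR].
    exists O; discriminate. }
  split.
  (* Excluded middle turns the two implications into the stated dichotomy. *)
  - destruct (classic (ex_series a)) as [[S HS]|NS]; [left|right].
    + split; [exists S; exact HS|]. eexists.
      apply is_improper_int_lim; [intros c; apply Hint, Rle_refl|].
      apply series_to_int, HS.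
    + split; [exact NS|]. intros [I HI]. apply NS, (int_to_series I).
      apply is_improper_int_lim; [intros c; apply Hint, Rle_refl | exact HI].
  - intros HS n. assert (n0 := pos_INR n).
    apply Series_correct in HS. set (S := Series a) in *.
    specialize (series_to_int S HS).
    set (I := T + S - (f 0 - L) / 2) in *.
    (* [eps1] is minus the trapezoidal error accumulated from [n] to infinity. *)
    exists (I - RInt f 0 (INR n)), L, (trapezoid_error f n - T).
    split; [|split; [exact HL|split]].
    + apply is_improper_int_lim; [intros c; apply Hint, n0|].
      apply is_lim_ext_loc with (fun c => RInt f 0 c - RInt f 0 (INR n)).
      { exists (INR n). intros c Hc.
        rewrite <- (RInt_Chasles f 0 (INR n) c) by (apply Hint; lra).
        unfold plus; simpl; ring. }
      apply is_lim_minus'; [exact series_to_int | apply is_lim_const].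
    + unfold I, trapezoid_error. fold a. field.
    + rewrite <- (pV_ray_finite f 0 (INR n) Hbv n0). fold (W (INR n)). simpl.
      (* The bound on the error between [n] and [n + j] is at most [W (INR n) / 2] for every [j],
         and passes to the limit in [j]. *)
      apply (is_lim_seq_le
        (fun j => Rabs (trapezoid_error f n - trapezoid_error f (n + j)))
        (fun _ => 1 / 2 * W (INR n)) (Rabs (trapezoid_error f n - T))
        (1 / 2 * W (INR n))).
      * intros j. rewrite Rabs_minus_sym.
        apply Rle_trans with (1 := trapezoid_error_bound W f n j HW).
        generalize (W0 _ (pos_INR (n + j))); lra.
      * apply (is_lim_seq_abs _ (trapezoid_error f n - T)), is_lim_seq_minus';
          [apply is_lim_seq_const|].
        apply is_lim_seq_ext with (fun j => trapezoid_error f (j + n)).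
        { intros j; rewrite Nat.add_comm; reflexivity. }
        apply is_lim_seq_incr_n, HT.
      * apply is_lim_seq_const.
Qed.
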